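(* Let $A\in\mathbb{R}^{n\times n}$ be symmetric positive semi-definite and let $V\in\mathbb{R}^{n\times r}$ have orthonormal columns. Let $J$ be the index set returned by the algorithm ''Nyström with deterministic adaptive pivoting'' applied to $A$ and $V$, and assume that $A(J,J)$ is invertible. Then $$\|A-A(:,J)A(J,J)^{-1}A(J,:)\|_*\le (r+1)\,\|(\mathrm{Id}-VV^T)A(\mathrm{Id}-VV^T)\|_* .$$
   Context: $\|\cdot\|_*$ is the nuclear norm (the sum of the singular values); $\dagger$ denotes the Moore-Penrose pseudoinverse. For an index tuple $J$, $A(:,J)$, $A(J,:)$, $A(J,J)$ denote the submatrices of $A$ with columns $J$, with rows $J$, and with rows and columns $J$, respectively. For $J_k=(j_1,\ldots,j_k)$, $E_{J_k}=[e_{j_1},\ldots,e_{j_k}]\in\mathbb{R}^{n\times k}$, with $e_j$ the $j$th unit vector. Nyström with deterministic adaptive pivoting. Input: symmetric positive semi-definite $A\in\mathbb{R}^{n\times n}$ and $V\in\mathbb{R}^{n\times r}$ with orthonormal columns. (1) Compute $Y=AV$ and let $d_1,\ldots,d_n$ be the diagonal entries of $\widetilde A_0=A-VY^T-YV^T+V(V^TY)V^T=(\mathrm{Id}-VV^T)A(\mathrm{Id}-VV^T)$. Set $J_0=()$ and $W_0=V$. (2) For $k=1,\ldots,r$: (a) choose $j_k\in\arg\min_j d_j/\|W_{k-1}(j,k:r)\|_2^2$, where $W_{k-1}(j,k:r)$ is row $j$ restricted to columns $k,\ldots,r$ and the minimum is over those $j$ for which the denominator is nonzero; set $J_k=(J_{k-1},j_k)$;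 (b) set $W_k=W_{k-1}Q_k$, where $Q_k=\mathrm{diag}(\mathrm{Id}_{k-1},H_k)\in\mathbb{R}^{r\times r}$ and $H_k$ is a Householder reflector $\mathrm{Id}-2u_ku_k^T$ of size $r-k+1$ with a unit vector $u_k$ (or the identity, if there is nothing to annihilate), chosen such that $W_k(j_k,k+1:r)=0$; (c) compute $$w_k=(\mathrm{Id}-V(E_{J_{k-1}}^TV)^\dagger E_{J_{k-1}}^T)(\mathrm{Id}-VV^T)A(\mathrm{Id}-VV^T)(\mathrm{Id}-E_{J_{k-1}}(V^TE_{J_{k-1}})^\dagger V^T)e_{j_k},$$ where for $k=1$ the first and last factors are identity matrices; (d) update $d_j\leftarrow d_j-2\dfrac{w_k(j)W_k(j,k)}{W_k(j_k,k)}+\dfrac{w_k(j_k)W_k(j,k)^2}{W_k(j_k,k)^2}$ for $j=1,\ldots,n$. (3) Output $J=J_r$. *)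

(* Defs.v *)
From HB Require Import structures.
From mathcomp Require Import all_boot all_order all_algebra.
From mathcomp Require Import polyrcf reals.

Set Implicit Arguments.
Unset Strict Implicit.
Unset Printing Implicit Defensive.

Import Order.TTheory GRing.Theory Num.Theory.
Local Open Scope ring_scope.

Section MatrixNotions.
Variable R : rcfType.

Definition sympsd n (A : 'M[R]_n) : Prop :=
  A^T = A /\ forall x : 'cV[R]_n, 0 <= (x^T *m A *m x) 0 0.

(* [rootsR] lists the roots without repetition, hence the [nseq]; [A^T *m A]
   has [n] eigenvalues, so if [m < n] there are [n - m] extra zeros. *)
Definition singular_values m n (A : 'M[R]_(m, n)) : seq R :=
  let p := char_poly (A^T *m A) in
  flatten [seq nseq (mup x p) (Num.sqrt x) | x <- rootsR p].

Definition nuclear_norm m n (A : 'M[R]_(m, n)) : R :=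
  \sum_(s <- singular_values A) s.

Definition is_pinv m n (A : 'M[R]_(m, n)) (X : 'M[R]_(n, m)) : bool :=
  [&& A *m X *m A == A, X *m A *m X == X,
      (A *m X)^T == A *m X & (X *m A)^T == X *m A].

Lemma gram_unit m n (A : 'M[R]_(m, n)) : row_free A -> A *m A^T \in unitmx.
Proof.
move=> fA; rewrite -row_free_unit -kermx_eq0; apply/rowV0P => v /sub_kermxP vK.
have: (v *m A) *m (v *m A)^T = 0.
  by rewrite trmx_mul mulmxA -(mulmxA v) vK mul0mx.
move/matrixP => /(_ 0 0); rewrite !mxE => /eqP.
under eq_bigr => i _ do rewrite [X in _ * X]mxE -expr2.
rewrite psumr_eq0 => [/allP s0|i _]; last exact: sqr_ge0.
apply: (row_free_inj fA); rewrite mul0mx; apply/rowP => i.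
by rewrite [RHS]mxE; apply/eqP; rewrite -sqrf_eq0; exact: (s0 i (mem_index_enum _)).
Qed.

Lemma is_pinv_factor m n k (C : 'M[R]_(m, k)) (D : 'M[R]_(k, n)) :
  row_full C -> row_free D ->
  is_pinv (C *m D)
    (D^T *m invmx (D *m D^T) *m (invmx (C^T *m C) *m C^T)).
Proof.
move=> fC /gram_unit uD.
have uC : C^T *m C \in unitmx.
  rewrite -{2}[C]trmxK; apply: gram_unit.
  by rewrite -row_leq_rank mxrank_tr; move: fC => /eqP ->.
pose D' := D^T *m invmx (D *m D^T); pose C' := invmx (C^T *m C) *m C^T.
have DD : D *m D' = 1%:M by rewrite mulmxA mulmxV.
have CC : C' *m C = 1%:M by rewrite -mulmxA mulVmx.
have AX : C *m D *m (D' *m C') = C *m C'.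
  by rewrite mulmxA -(mulmxA C) DD mulmx1.
have XA : D' *m C' *m (C *m D) = D' *m D.
  by rewrite mulmxA -(mulmxA D') CC mulmx1.
rewrite -/D' -/C' /is_pinv AX XA; apply/and4P; split; apply/eqP.
- by rewrite mulmxA -(mulmxA C) CC mulmx1.
- by rewrite mulmxA -(mulmxA D') DD mulmx1.
- by rewrite /C' !trmx_mul trmxK trmx_inv !trmx_mul !trmxK mulmxA.
- by rewrite /D' !trmx_mul trmxK trmx_inv !trmx_mul !trmxK mulmxA.
Qed.

Lemma pinv_exists m n (A : 'M[R]_(m, n)) : exists X, is_pinv A X.
Proof.
have := is_pinv_factor (col_base_full A) (row_base_free A).
set X := (X in is_pinv _ X); rewrite mulmx_base => AX; by exists X.
Qed.

Lemma pinv_unique m n (A : 'M[R]_(m, n)) (X Y : 'M[R]_(n, m)) :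
  is_pinv A X -> is_pinv A Y -> X = Y.
Proof.
case/and4P => /eqP X1 /eqP X2 /eqP X3 /eqP X4.
case/and4P => /eqP Y1 /eqP Y2 /eqP Y3 /eqP Y4.
have AXY : A *m X = A *m Y.
  rewrite -{1}Y1 -(mulmxA (A *m Y)) -Y3 -X3 -trmx_mul.
  by rewrite mulmxA X1.
have XAY : X *m A = Y *m A.
  rewrite -{1}Y1 -!(mulmxA A) mulmxA -Y4 -X4 -trmx_mul.
  by rewrite -(mulmxA Y) (mulmxA A) X1.
by rewrite -X2 XAY -mulmxA AXY mulmxA Y2.
Qed.

(* Not the library's [pinvmx], which is only a generalized inverse; by
   [pinv_unique] the choice is forced. *)
Definition pinv m n (A : 'M[R]_(m, n)) : 'M[R]_(n, m) :=
  xchoose (pinv_exists A).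

End MatrixNotions.

Section Nystrom.
Variable R : rcfType.

(* [E_s = [e_{s_1}, ..., e_{s_k}]] for the index tuple [s] of length [k]. *)
Definition select n (s : seq 'I_n) : 'M[R]_(n, size s) :=
  colsub (tnth (in_tuple s)) 1%:M.

Definition householder m (u : 'cV[R]_m) : 'M[R]_m := 1%:M - 2 *: (u *m u^T).

Definition householder_or_id m (H : 'M[R]_m) : Prop :=
  (exists2 u : 'cV[R]_m, u^T *m u = 1%:M & H = householder u) \/ H = 1%:M.

(* [diag(Id_k, H)]; the cast only identifies [k + (r - k)] with [r]. *)
Definition extend_id r (k : 'I_r) (H : 'M[R]_(r - k)) : 'M[R]_r :=
  let kr := subnKC (ltnW (ltn_ord k)) in
  castmx (kr, kr) (block_mx (1%:M : 'M_k) 0 0 H).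

Definition row_tail_sqnorm n r (W : 'M[R]_(n, r)) (j : 'I_n) (k : nat) : R :=
  \sum_(l < r | (k <= l)%N) W j l ^+ 2.

Definition is_argmin (I : finType) (P : pred I) (f : I -> R) (i : I) : Prop :=
  P i /\ forall j, P j -> f i <= f j.

Definition residual_column n r (A : 'M[R]_n) (V : 'M[R]_(n, r))
    (s : seq 'I_n) (j : 'I_n) : 'cV[R]_n :=
  let E := select s in
  (1%:M - V *m pinv (E^T *m V) *m E^T) *m (1%:M - V *m V^T) *m A
    *m (1%:M - V *m V^T) *m (1%:M - E *m pinv (V^T *m E) *m V^T)
    *m delta_mx j 0.

Definition initial_diag n r (A : 'M[R]_n) (V : 'M[R]_(n, r)) (j : 'I_n) : R :=
  let Y := A *m V in
  (A - V *m Y^T - Y *m V^T + V *m (V^T *m Y) *m V^T) j j.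

(* Indices start at [0]: [k : 'I_r] is the iteration numbered [k + 1] in the
   usual one-based description, and [s] is the tuple of the [k] indices selected
   before it. For [s = [::]] both [pinv] terms of [residual_column] are empty
   products, so that the outer factors are identity matrices. The case [H = 1]
   can only occur when there is nothing to annihilate, by the condition on
   [W']. *)
Definition nystrom_step n r (A : 'M[R]_n) (V : 'M[R]_(n, r)) (k : 'I_r)
    (s : seq 'I_n) (jk : 'I_n)
    (W : 'M[R]_(n, r)) (d : 'I_n -> R)
    (W' : 'M[R]_(n, r)) (d' : 'I_n -> R) : Prop :=
  [/\ is_argmin (fun j => row_tail_sqnorm W j k != 0)
                (fun j => d j / row_tail_sqnorm W j k) jk,
      exists2 H : 'M[R]_(r - k),
        householder_or_id H & W' = W *m extend_id H,
      forall l : 'I_r, (k < l)%N -> W' jk l = 0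
    & let w := residual_column A V s jk in
      forall j, d' j = d j - 2 * (w j 0 * W' j k / W' jk k)
                       + w jk 0 * W' j k ^+ 2 / W' jk k ^+ 2].

(* The algorithm leaves ties in the minimum and the reflectors unspecified, so
   its possible outputs form a relation: [J] is output if it is obtained for
   some admissible sequence of these choices. *)
Definition adaptive_nystrom_output n r (A : 'M[R]_n) (V : 'M[R]_(n, r))
    (J : r.-tuple 'I_n) : Prop :=
  exists (W : nat -> 'M[R]_(n, r)) (d : nat -> 'I_n -> R),
    [/\ W 0%N = V,
        forall j, d 0%N j = initial_diag A V j
      & forall k : 'I_r,
          nystrom_step A V k (take k J) (tnth J k)
            (W k) (d k) (W k.+1) (d k.+1)].

End Nystrom.

(* Main.v *)
Require Import Defs.
From mathcomp Require Import all_boot all_order all_algebra.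
From mathcomp Require Import polyrcf complex spectral sesquilinear.
From mathcomp Require Import reals ring lra.

(* Write B = (1 - V V^T) A (1 - V V^T) and T_k = 1 - V (E_k^T V)^+ E_k^T for the
   selected indices J_k; the algorithm maintains d = diag (T_k B T_k^T).  If w
   is column k+1 of W_{k+1} and j the new index, then
   T_{k+1} = (1 - w e_j^T / w_j) T_k.  Since w lies in the range of V and
   vanishes on J_k, w^T T_k B = w^T B = 0, so the trace of T_k B T_k^T grows by
   exactly d_j / w_j^2, the minimal ratio.  The denominators
   ||W_k(i, k+1:r)||^2 add up to r - k, hence the growth factor is at most
   1 + 1/(r - k), and these factors telescope to r + 1.  Finally T_r V = 0, so
   T_r B T_r^T = T_r A T_r^T, whose trace is at least that of the Schur
   complement; for positive semidefinite matrices nuclear norm is trace. *)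

Set Implicit Arguments.
Unset Strict Implicit.
Unset Printing Implicit Defensive.

Import Order.TTheory GRing.Theory Num.Theory.
Local Open Scope ring_scope.

(** * Real spectral theorem, and the nuclear norm of positive semidefinite matrices *)

Lemma char_poly_conj (F : fieldType) n (P A : 'M[F]_n) :
  P \in unitmx -> char_poly (invmx P *m A *m P) = char_poly A.
Proof.
move=> uP; rewrite /char_poly /char_poly_mx.
have PP : map_mx polyC (invmx P) *m map_mx polyC P = 1%:M.
  by rewrite -map_mxM mulVmx // map_mx1.
have -> : 'X%:M - map_mx polyC (invmx P *m A *m P) =
    map_mx polyC (invmx P) *m ('X%:M - map_mx polyC A) *m map_mx polyC P.
  rewrite mulmxBr mulmxBl !map_mxM; congr (_ - _).
  by rewrite scalar_mxC -mulmxA PP mulmx1.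
by rewrite !det_mulmx mulrAC -det_mulmx PP det1 mul1r.
Qed.

Section RealSymmetric.
Variable R : rcfType.

(** Over [R[i]] the matrix is hermitian, so its eigenvalues are real; real matrices that are similar
    over [R[i]] are already similar over [R]. The real [P] so obtained is only claimed to be
    invertible. *)
Lemma sym_diagonalizable n (A : 'M[R]_n) : A^T = A ->
  exists (P : 'M[R]_n) (D : 'rV[R]_n),
    P \in unitmx /\ A = invmx P *m diag_mx D *m P.
Proof.
move=> symA; pose C := map_mx (real_complex R).
have realC m p (M : 'M[R]_(m, p)) : C m p M \is a mxOver Num.real.
  by apply/mxOverP => i j; rewrite mxE; apply/complex_realP; exists (M i j).
have ReC m p (M : 'M[R[i]]_(m, p)) :
    M \is a mxOver Num.real -> exists M', M = C m p M'.
  move=> /mxOverP rM; exists (map_mx (@complex.Re R) M).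
  by apply/matrixP => i j; rewrite !mxE; apply/esym/RRe_real/rM.
have hA : C n n A \is hermsymmx.
  apply: realsym_hermsym; last exact: realC.
  apply/is_hermitianmxP.
  by rewrite expr0 scale1r -{1}symA map_mx_id // map_trmx.
have /orthomx_spectralP := hermitian_normalmx hA.
have := hermitian_spectral_diag_real hA.
set P := spectralmx _; set D := spectral_diag _ => /ReC[D' ->] eA.
have uP : P \in unitmx by apply: spectral_unit.
have sim : similar_in unitmx (C n n A) (diag_mx (C 1 n D')).
  exists P => //; apply/similarP => //.
  by rewrite eA !mulmxA mulmxV // mul1mx.
have [||Q /andP[/ReC[Q' ->]]] := real_similar sim; first exact: realC.
  by rewrite -map_diag_mx; exact: realC.
rewrite map_unitmx => uQ /(similarP _) sQ.
exists Q', D'; split=> //.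
apply: (can_inj (mulKmx uQ)); rewrite !mulmxA mulmxV // mul1mx.
have {sQ} := sQ _; rewrite map_unitmx => /(_ uQ).
rewrite -map_diag_mx -!map_mxM; apply: map_mx_inj.
Qed.

(** [A^T *m A] is the square of [A], so its eigenvalues are the [D 0 i ^+ 2]; their square roots are
    the [D 0 i] themselves once these are known to be nonnegative. *)
Lemma nuclear_norm_psd n (A : 'M[R]_n) : sympsd A -> nuclear_norm A = \tr A.
Proof.
move=> [symA psdA]; have [P [D [uP eA]]] := sym_diagonalizable symA.
have PA : P *m A = diag_mx D *m P by rewrite eA !mulmxA mulmxV // mul1mx.
(* Row [i] of [P] is a left eigenvector of [A] with Rayleigh quotient [D 0 i]. *)
have D_ge0 i : 0 <= D 0 i.
  pose p := row i P.
  have pA : p *m A = D 0 i *: p.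
    by rewrite /p -row_mul PA row_mul row_diag_mx -scalemxAl -rowE.
  have pp : (p *m p^T) 0 0 = \sum_j p 0 j ^+ 2.
    by rewrite mxE; apply: eq_bigr => j _; rewrite [X in _ * X]mxE.
  have pp_gt0 : 0 < (p *m p^T) 0 0.
    rewrite pp lt_def sumr_ge0 ?andbT => [|j _]; last exact: sqr_ge0.
    apply/negP; rewrite psumr_eq0 => [/allP p0|j _]; last exact: sqr_ge0.
    have : p *m invmx P = 0.
      rewrite (_ : p = 0) ?mul0mx //; apply/rowP => j; rewrite [RHS]mxE.
      by apply/eqP; rewrite -sqrf_eq0; apply: p0 (mem_index_enum _).
    rewrite -row_mul mulmxV // => /matrixP/(_ 0 i)/eqP.
    by rewrite !mxE eqxx oner_eq0.
  have := psdA p^T; rewrite trmxK pA -scalemxAl mxE.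
  by rewrite pmulr_lge0.
have -> : \tr A = \sum_i D 0 i.
  by rewrite eA mxtrace_mulC mulmxA mulmxV // mul1mx mxtrace_diag.
pose s := [seq D 0 i ^+ 2 | i <- enum 'I_n].
have eS : char_poly (A^T *m A) = \prod_(x <- s) ('X - x%:P).
  have -> : A^T *m A = invmx P *m (diag_mx D *m diag_mx D) *m P.
    by rewrite symA {1}eA -!mulmxA PA.
  rewrite char_poly_conj // mulmx_diag char_poly_trig ?diag_mx_is_trig //.
  rewrite big_map big_enum; apply: eq_bigr => i _.
  by rewrite !mxE eqxx mulr1n expr2.
rewrite /nuclear_norm /singular_values eS; set p := \prod_(x <- s) _.
have p0 : p != 0 by rewrite monic_neq0 ?monic_prod_XsubC.
rewrite big_flatten big_map.
under eq_bigr => x _ do rewrite mu_prod_XsubC big_nseq iter_addr_0.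
have memr x : (x \in rootsR p) = (x \in s).
  by have := roots_on_rootsR p0 x; rewrite inE /= root_prod_XsubC.
have ur : uniq (rootsR p) by apply: uniq_roots.
transitivity (\sum_(x <- s) Num.sqrt x); last first.
  rewrite big_map big_enum; apply: eq_bigr => i _.
  by rewrite sqrtr_sqr ger0_norm.
(* Equal terms are grouped, to match roots listed once and weighted by multiplicity. *)
rewrite -[RHS]big_undup_iterop_count /=.
rewrite [RHS](perm_big (rootsR p)) /=; last first.
  by apply: uniq_perm; rewrite ?undup_uniq // => x; rewrite mem_undup memr.
by apply: eq_bigr => x _.
Qed.

End RealSymmetric.

(** * Congruences and Schur complements of positive semidefinite matrices *)

Section Psd.
Variable R : rcfType.

Lemma sympsd_congr m n (A : 'M[R]_n) (X : 'M[R]_(m, n)) :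
  sympsd A -> sympsd (X *m A *m X^T).
Proof.
move=> [symA psdA]; split=> [|x]; first by rewrite !trmx_mul trmxK symA mulmxA.
by have := psdA (X^T *m x); rewrite trmx_mul trmxK !mulmxA.
Qed.

Lemma sympsd_diag_ge0 n (A : 'M[R]_n) i : sympsd A -> 0 <= A i i.
Proof.
by case=> _ /(_ (delta_mx i 0)); rewrite trmx_delta -rowE -colE !mxE.
Qed.

Lemma sympsd_trace_ge0 n (A : 'M[R]_n) : sympsd A -> 0 <= \tr A.
Proof. by move=> psdA; apply: sumr_ge0 => i _; exact: sympsd_diag_ge0. Qed.

(** With [G = E^T A E], the matrix [1 - A E G^-1 E^T] annihilates [A E] from the left, so the Schur
    complement is the congruence of [A] by it. *)
Lemma schur_sympsd n k (A : 'M[R]_n) (E : 'M[R]_(n, k)) :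
  sympsd A -> E^T *m A *m E \in unitmx ->
  sympsd (A - A *m E *m invmx (E^T *m A *m E) *m (E^T *m A)).
Proof.
move=> psdA uG; set G := E^T *m A *m E; set C := A *m E.
have symA := proj1 psdA.
have EA : E^T *m A = C^T by rewrite trmx_mul symA.
have symG : G^T = G by rewrite !trmx_mul trmxK symA mulmxA.
suff -> : A - C *m invmx G *m (E^T *m A) =
    (1%:M - C *m invmx G *m E^T) *m A *m (1%:M - C *m invmx G *m E^T)^T.
  exact: sympsd_congr.
rewrite linearB /= trmx1 !trmx_mul trmxK trmx_inv symG EA.
rewrite mulmxBl mul1mx -(mulmxA _ E^T A) EA mulmxBr mulmx1 mulmxBl.
have GE : C^T *m E = G by rewrite -EA.
rewrite !mulmxA -[A *m E]/C -(mulmxA (C *m invmx G) C^T E) GE.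
by rewrite mulmxKV // subrr subr0.
Qed.

(* Among all [M], [M = C G^-1] minimizes the trace of the congruence by
   [1 - M E^T]; completing the square gives the difference. *)
Lemma schur_trace_le n k (A : 'M[R]_n) (E M : 'M[R]_(n, k)) :
  sympsd A -> E^T *m A *m E \in unitmx ->
  \tr (A - A *m E *m invmx (E^T *m A *m E) *m (E^T *m A)) <=
  \tr ((1%:M - M *m E^T) *m A *m (1%:M - M *m E^T)^T).
Proof.
move=> psdA uG; set G := E^T *m A *m E; set C := A *m E.
have symA := proj1 psdA.
have EA : E^T *m A = C^T by rewrite trmx_mul symA.
have symG : G^T = G by rewrite !trmx_mul trmxK symA mulmxA.
have psdG : sympsd G by rewrite /G -{2}[E]trmxK; exact: sympsd_congr.
have GE : C^T *m E = G by rewrite -EA.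
rewrite -/G in uG; have AE : A *m E = C by [].
have := sympsd_trace_ge0 (sympsd_congr (M - C *m invmx G) psdG).
clearbody G C.
rewrite -[X in _ -> is_true X]subr_ge0 -raddfB /=; congr (0 <= \tr _).
rewrite !linearB /= trmx1 !trmx_mul !trmxK trmx_inv symG EA.
rewrite !mulmxBl !mul1mx ?mulmxBr ?mulmx1 ?mulmxBl.
rewrite -!(mulmxA M E^T A) EA !mulmxA AE -(mulmxA M C^T E) GE.
rewrite !(mulmxKV uG) !(mulmxK uG).
rewrite !opprB opprK.
move: (M *m G *m M^T) (C *m M^T) (M *m C^T) (C *m invmx G *m C^T) => a b c d.
by apply/matrixP => i j; rewrite !mxE; ring.
Qed.

End Psd.

(** * Pseudoinverses and the deflating matrices [T_k] *)

Section Oblique.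
Variable R : rcfType.

Lemma pinvP m n (A : 'M[R]_(m, n)) : is_pinv A (pinv A).
Proof. exact: xchooseP. Qed.

Lemma pinv_tr m n (A : 'M[R]_(m, n)) : pinv A^T = (pinv A)^T.
Proof.
apply: pinv_unique (pinvP _) _.
case/and4P: (pinvP A) => /eqP X1 /eqP X2 /eqP X3 /eqP X4.
by apply/and4P; split; rewrite -!trmx_mul ?mulmxA ?X1 ?X2 ?X3 ?X4.
Qed.

(** The columns of [pinv A] lie in the range of [A^T], which is orthogonal to the kernel of [A]. *)
Lemma pinv_kerl m n p (A : 'M[R]_(m, n)) (q : 'M[R]_(n, p)) :
  A *m q = 0 -> q^T *m pinv A = 0.
Proof.
case/and4P: (pinvP A) => _ /eqP X2 _ /eqP X4 Aq0.
by rewrite -X2 -X4 trmx_mul !mulmxA -trmx_mul Aq0 trmx0 !mul0mx.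
Qed.

Definition vanishes n p (s : seq 'I_n) (M : 'M[R]_(n, p)) :=
  forall i j, i \in s -> M i j = 0.

Lemma vanishesP n p (s : seq 'I_n) (M : 'M[R]_(n, p)) :
  vanishes s M <-> (select R s)^T *m M = 0.
Proof.
have E i j : ((select R s)^T *m M) i j = M (tnth (in_tuple s) i) j.
  rewrite mxE (bigD1 (tnth (in_tuple s) i)) //= big1 => [|l nl].
    by rewrite !mxE eqxx mul1r addr0.
  by rewrite !mxE (negPf nl) mul0r.
split=> [v0|/matrixP e0 i j /(tnthP (in_tuple s))[l ->]].
  apply/matrixP => i j; rewrite E mxE v0 //.
  by rewrite -[s]/(tval (in_tuple s)) mem_tnth.
by rewrite -E e0 mxE.
Qed.

(* For [E_s^T V] of full row rank there is exactly one such [T], namely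
   [1 - V (E_s^T V)^+ E_s^T]; see [deflatorE]. *)
Definition oblique n r (V : 'M[R]_(n, r)) (s : seq 'I_n) (T : 'M[R]_n) :=
  [/\ exists N, T = 1%:M - V *m N,
      forall q : 'cV[R]_r, vanishes s (V *m q) -> (V *m q)^T *m T = (V *m q)^T
    & vanishes s T].

Definition deflator n r (V : 'M[R]_(n, r)) (s : seq 'I_n) : 'M[R]_n :=
  1%:M - V *m pinv ((select R s)^T *m V) *m (select R s)^T.

(** Since [V] has orthonormal columns, the correction term is [q^T] times the pseudoinverse of
    [E_s^T V], and [q] lies in the kernel of [E_s^T V]. *)
Lemma deflator_fix n r (V : 'M[R]_(n, r)) (s : seq 'I_n) (q : 'cV[R]_r) :
  V^T *m V = 1%:M -> vanishes s (V *m q) ->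
  (V *m q)^T *m deflator V s = (V *m q)^T.
Proof.
move=> hV /vanishesP vq; rewrite mulmxBr mulmx1 !mulmxA.
rewrite trmx_mul -(mulmxA q^T) hV mulmx1 pinv_kerl ?mul0mx ?subr0 //.
by rewrite -mulmxA.
Qed.

(* Both matrices vanish on [s], hence so do the columns of their difference
   [V D], which both matrices therefore fix from the left: [D^T D = 0]. *)
Lemma deflatorE n r (V : 'M[R]_(n, r)) (s : seq 'I_n) (T : 'M[R]_n) :
  V^T *m V = 1%:M -> oblique V s T -> deflator V s = T.
Proof.
move=> hV [[N eT] fixT vT]; set T' := deflator V s.
(* With [E] for [E_s^T], vanishing of [T] says [E = E V N]; the Penrose identity then gives
   [E V (E V)^+ E = E]. *)
have vT' : vanishes s T'.
  apply/vanishesP; move/vanishesP: vT; rewrite eT !mulmxBr mulmx1 !mulmxA.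
  set E := (select R s)^T => /eqP; rewrite subr_eq0 => /eqP EVN.
  case/and4P: (pinvP (E *m V)) => /eqP X1 _ _ _.
  by rewrite {1 4}EVN mulmxA X1 subrr.
pose D := V^T *m (T' - T).
have eD : V *m D = T' - T.
  rewrite /D; have -> : T' - T =
      V *m (N - pinv ((select R s)^T *m V) *m (select R s)^T).
    by rewrite eT /T' /deflator mulmxBr mulmxA opprB addrC addrA subrK.
  by congr (V *m _); rewrite mulmxA hV mul1mx.
have DD : D^T *m D = 0.
  apply/row_matrixP => j; rewrite row_mul row0 -tr_col /D mulmxA -trmx_mul.
  set q := col j D; have vq : vanishes s (V *m q).
    move=> i l si; rewrite /q colE mulmxA -colE eD mxE [LHS]mxE vT' //.
    by rewrite [X in _ + X]mxE vT // subr0.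
  by rewrite mulmxBr deflator_fix // fixT // subrr.
clearbody D; apply/subr0_eq; rewrite -eD; suff -> : D = 0 by rewrite mulmx0.
apply/matrixP => k l; rewrite [RHS]mxE.
move/matrixP/(_ l l): DD; rewrite !mxE => /eqP.
under eq_bigr => m _ do rewrite mxE -expr2.
rewrite psumr_eq0 => [/allP s0|m _]; last exact: sqr_ge0.
by apply/eqP; rewrite -sqrf_eq0; exact: (s0 k (mem_index_enum _)).
Qed.

(** The rank-one factor clears row [j] and keeps the zero rows in [s], where [w] vanishes. It fixes
    the vectors concerned because they are orthogonal to [w]. *)
Lemma oblique_rcons n r (V : 'M[R]_(n, r)) (s : seq 'I_n) (T : 'M[R]_n)
    (j : 'I_n) (q0 : 'cV[R]_r) :
  let w := V *m q0 in
  oblique V s T -> vanishes s w -> w j 0 != 0 ->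
  (forall q : 'cV[R]_r, vanishes (rcons s j) (V *m q) -> (V *m q)^T *m w = 0) ->
  oblique V (rcons s j)
    ((1%:M - (w j 0)^-1 *: (w *m (delta_mx j 0)^T)) *m T).
Proof.
move=> w [[N eT] fixT vT] vw wj worth; split.
- exists (N + (w j 0)^-1 *: (q0 *m (delta_mx j 0)^T *m T)).
  rewrite mulmxBl mul1mx {1}eT mulmxDr opprD addrA; congr (_ - _).
  by rewrite -scalemxAr !mulmxA scalemxAl.
- move=> q vq; rewrite mulmxA mulmxBr mulmx1 -scalemxAr mulmxA worth // mul0mx.
  rewrite scaler0 subr0 fixT // => i l si; apply: vq.
  by rewrite mem_rcons inE si orbT.
- move=> i l; clearbody w; rewrite mulmxBl mul1mx -scalemxAl -mulmxA.
  rewrite trmx_delta -rowE !mxE big_ord1 !mxE mem_rcons inE => /orP[/eqP->|si].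
    by rewrite mulrA mulVf // mul1r subrr.
  by rewrite vT // (vw i) // mul0r mulr0 subrr.
Qed.

End Oblique.

(** * Reflections of the trailing columns and the row weights *)

Section Rotation.
Variable R : rcfType.

Lemma householder_or_id_orth m (H : 'M[R]_m) :
  householder_or_id H -> H^T *m H = 1%:M.
Proof.
case=> [[u uu ->]|->]; last by rewrite trmx1 mulmx1.
rewrite /householder [_^T]linearB /= trmx1 [_^T]linearZ /= trmx_mul trmxK.
rewrite mulmxBl mul1mx mulmxBr mulmx1 -scalemxAl -scalemxAr.
rewrite mulmxA -(mulmxA u) uu mulmx1.
by move: (u *m u^T) => B; apply/matrixP => i j; rewrite !mxE; ring.
Qed.

Definition fixes_head r k (Q : 'M[R]_r) :=
  forall l l' : 'I_r, (l < k)%N || (l' < k)%N -> Q l l' = (l == l')%:R.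

(** A free [m] in place of [r - k] lets [e] be destructed, which removes the cast. *)
Lemma cast_block1_orth k m r (e : (k + m)%N = r) (H : 'M[R]_m) :
  let Q := castmx (e, e) (block_mx (1%:M : 'M_k) 0 0 H) in
  H^T *m H = 1%:M -> Q^T *m Q = 1%:M /\ fixes_head k Q.
Proof.
case: r / e => /=; rewrite castmx_id => HH; split.
  rewrite tr_block_mx mulmx_block !trmx0 trmx1 !mul0mx !mulmx0 HH mulmx1.
  by rewrite !addr0 add0r -scalar_mx_block.
move=> l l'; case: (split_ordP l) => a ->; case: (split_ordP l') => b ->.
- by rewrite block_mxEul mxE (inj_eq (@lshift_inj _ _)).
- by rewrite block_mxEur mxE eq_lrshift.
- by rewrite block_mxEdl mxE eq_rlshift.
- by [].
Qed.

Lemma extend_id_orth r (k : 'I_r) (H : 'M[R]_(r - k)) :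
  householder_or_id H ->
  (extend_id H)^T *m extend_id H = 1%:M /\ fixes_head k (extend_id H).
Proof. by move=> /householder_or_id_orth; exact: cast_block1_orth. Qed.

Lemma fixes_head_mulr n r k (W : 'M[R]_(n, r)) (Q : 'M[R]_r) i (l : 'I_r) :
  fixes_head k Q -> (l < k)%N -> (W *m Q) i l = W i l.
Proof.
move=> fQ lk; rewrite mxE (bigD1 l) //= big1 => [|l' nl].
  by rewrite fQ ?lk // eqxx mulr1 addr0.
by rewrite fQ ?lk ?orbT // (negPf nl) mulr0.
Qed.

Lemma fixes_head_mull p r k (q : 'M[R]_(r, p)) (Q : 'M[R]_r) (l : 'I_r) j :
  fixes_head k Q -> (l < k)%N -> (Q *m q) l j = q l j.
Proof.
move=> fQ lk; rewrite mxE (bigD1 l) //= big1 => [|l' nl].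
  by rewrite fQ ?lk // eqxx mul1r addr0.
by rewrite fQ ?lk // eq_sym (negPf nl) mul0r.
Qed.

(** The tail is the full row norm, invariant under orthogonal [Q], minus the head, which [Q] leaves
    untouched. *)
Lemma row_tail_sqnorm_rot n r k (W : 'M[R]_(n, r)) (Q : 'M[R]_r) i :
  Q^T *m Q = 1%:M -> fixes_head k Q ->
  row_tail_sqnorm (W *m Q) i k = row_tail_sqnorm W i k.
Proof.
move=> /mulmx1C QQ fQ.
have tot (M : 'M[R]_(n, r)) : row_tail_sqnorm M i k =
    (M *m M^T) i i - \sum_(l < r | ~~ (k <= l)%N) M i l ^+ 2.
  rewrite mxE; under eq_bigr => l _ do rewrite mxE -expr2.
  by rewrite (bigID (fun l : 'I_r => (k <= l)%N)) /= addrK.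
rewrite !tot trmx_mul mulmxA -(mulmxA W) QQ mulmx1; congr (_ - _).
by apply: eq_bigr => l; rewrite -ltnNge => lk; rewrite (fixes_head_mulr _ _ fQ).
Qed.

Lemma row_tail_sqnorm_ge0 n r (W : 'M[R]_(n, r)) i k :
  0 <= row_tail_sqnorm W i k.
Proof. by apply: sumr_ge0 => l _; exact: sqr_ge0. Qed.

Lemma row_tail_sqnorm_eq0 n r (W : 'M[R]_(n, r)) i k :
  row_tail_sqnorm W i k = 0 <-> forall l : 'I_r, (k <= l)%N -> W i l = 0.
Proof.
split=> [/eqP|W0].
  rewrite psumr_eq0 => [/allP s0 l kl|l _]; last exact: sqr_ge0.
  by have := s0 l (mem_index_enum _); rewrite kl /= sqrf_eq0 => /eqP.
by apply: big1 => l kl; rewrite W0 // expr0n.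
Qed.

(** Summed by columns, each of the [r - k] trailing unit columns contributes 1. *)
Lemma sum_row_tail_sqnorm n r k (W : 'M[R]_(n, r)) :
  (k <= r)%N -> W^T *m W = 1%:M ->
  \sum_i row_tail_sqnorm W i k = (r - k)%:R.
Proof.
move=> kr WW; rewrite exchange_big /=.
transitivity (\sum_(l < r | (k <= l)%N) (1 : R)).
  apply: eq_bigr => l _; have : (W^T *m W) l l = 1 by rewrite WW mxE eqxx.
  rewrite mxE => <-.
  by apply: eq_bigr => i _; rewrite mxE expr2.
by rewrite -(big_geq_mkord k r xpredT (fun=> 1)) sumr_const_nat.
Qed.

End Rotation.

(** * One iteration: the loop invariant and the growth of the trace *)

Section Step.
Variable R : rcfType.

Definition compression n r (A : 'M[R]_n) (V : 'M[R]_(n, r)) : 'M[R]_n :=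
  (1%:M - V *m V^T) *m A *m (1%:M - V *m V^T).

Lemma compressor_sym n r (V : 'M[R]_(n, r)) :
  (1%:M - V *m V^T)^T = 1%:M - V *m V^T.
Proof. by rewrite [_^T]linearB /= trmx1 trmx_mul trmxK. Qed.

Lemma compression_sympsd n r (A : 'M[R]_n) (V : 'M[R]_(n, r)) :
  sympsd A -> sympsd (compression A V).
Proof.
by move=> psdA; rewrite /compression -{2}compressor_sym; exact: sympsd_congr.
Qed.

(** [pinv] commutes with transposition, so the two outer factors are transposes of each other. *)
Lemma residual_columnE n r (A : 'M[R]_n) (V : 'M[R]_(n, r)) s j :
  residual_column A V s j =
  col j (deflator V s *m compression A V *m (deflator V s)^T).
Proof.
rewrite colE /residual_column /compression /deflator; set E := select R s.
rewrite [X in _ = _ *m X *m _]linearB /= trmx1 !trmx_mul trmxK -pinv_tr.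
by rewrite trmx_mul trmxK !mulmxA.
Qed.

Lemma initial_diagE n r (A : 'M[R]_n) (V : 'M[R]_(n, r)) j :
  A^T = A -> initial_diag A V j = compression A V j j.
Proof.
move=> symA; rewrite /initial_diag /compression; congr (fun_of_matrix _ j j).
rewrite trmx_mul symA mulmxBr mulmx1 !mulmxBl !mul1mx !mulmxA.
by rewrite -addrA; congr (_ + _); rewrite opprB addrC.
Qed.

Definition elim_mx n (w : 'cV[R]_n) (j : 'I_n) (c : R) : 'M[R]_n :=
  1%:M - c *: (w *m (delta_mx j 0)^T).

Lemma elim_mx_entry n (M : 'M[R]_n) (w : 'cV[R]_n) j c i : M^T = M ->
  (elim_mx w j c *m M *m (elim_mx w j c)^T) i i =
  M i i - 2 * (c * (w i 0 * M i j)) + c ^+ 2 * (w i 0 ^+ 2 * M j j).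
Proof.
move=> symM; have Mji : M j i = M i j by rewrite -{1}symM mxE.
have e (N : 'M[R]_n) a b :
    (elim_mx w j c *m N) a b = N a b - c * (w a 0 * N j b).
  rewrite mulmxBl mul1mx -scalemxAl -mulmxA trmx_delta -rowE.
  by rewrite !mxE big_ord1 !mxE.
have -> : elim_mx w j c *m M *m (elim_mx w j c)^T =
    (elim_mx w j c *m (elim_mx w j c *m M)^T)^T.
  by rewrite trmx_mul trmxK.
by rewrite mxE e [_^T i i]mxE [_^T j i]mxE !e Mji; ring.
Qed.

(** The cross terms sum to an entry of [w^T *m M], hence to 0; the squares of the entries of the
    unit vector [w] sum to 1. *)
Lemma elim_mx_trace n (M : 'M[R]_n) (w : 'cV[R]_n) j c :
  M^T = M -> w^T *m M = 0 -> w^T *m w = 1%:M ->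
  \tr (elim_mx w j c *m M *m (elim_mx w j c)^T) = \tr M + c ^+ 2 * M j j.
Proof.
move=> symM wM ww; rewrite /mxtrace.
under eq_bigr => i _ do rewrite elim_mx_entry //.
rewrite big_split sumrB /= -!mulr_sumr -mulr_suml.
have -> : \sum_i w i 0 * M i j = 0.
  have : (w^T *m M) 0 j = 0 by rewrite wM mxE.
  rewrite mxE => wM0; rewrite -[RHS]wM0.
  by apply: eq_bigr => i _; rewrite mxE.
have -> : \sum_i w i 0 ^+ 2 = 1.
  have : (w^T *m w) 0 0 = 1 by rewrite ww mxE.
  by rewrite mxE => <-; apply: eq_bigr => i _; rewrite mxE expr2.
by rewrite !mulr0 subr0 mul1r.
Qed.

(* The weights [row_tail_sqnorm W i k] add up to [r - k], so the least ratio
   is at most the average one. *)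
Lemma argmin_ratio_le n r (k : nat) (M : 'M[R]_n) (W : 'M[R]_(n, r)) j :
  sympsd M -> (k <= r)%N -> W^T *m W = 1%:M ->
  is_argmin (fun i => row_tail_sqnorm W i k != 0)
            (fun i => M i i / row_tail_sqnorm W i k) j ->
  M j j / row_tail_sqnorm W j k * (r - k)%:R <= \tr M.
Proof.
move=> psdM kr WW [tj0 minj]; rewrite -(sum_row_tail_sqnorm kr WW) mulr_sumr.
apply: ler_sum => i _; have [->|ti0] := eqVneq (row_tail_sqnorm W i k) 0.
  by rewrite mulr0; exact: sympsd_diag_ge0.
rewrite -ler_pdivlMr; first exact: minj.
by rewrite lt_def ti0 row_tail_sqnorm_ge0.
Qed.

(** The second and third clauses together say that [W *m q] vanishes on [s] exactly when the first
    [k] entries of [q] are 0. The trace bound is the telescoped product of the factors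
    [(r + 1 - i) / (r - i)] for [i < k]. *)
Definition nystrom_invariant n r (A : 'M[R]_n) (V : 'M[R]_(n, r)) (k : nat)
    (s : seq 'I_n) (W : 'M[R]_(n, r)) (d : 'I_n -> R) : Prop :=
  let T := deflator V s in
  let M := T *m compression A V *m T^T in
  [/\ exists2 Q : 'M[R]_r, Q^T *m Q = 1%:M & W = V *m Q,
      forall i (l : 'I_r), i \in s -> (k <= l)%N -> W i l = 0,
      forall q : 'cV[R]_r, vanishes s (W *m q) ->
        forall l : 'I_r, (l < k)%N -> q l 0 = 0,
      oblique V s T
    & (forall j, d j = M j j) /\
      (r.+1 - k)%:R * \tr M <= r.+1%:R * \tr (compression A V)].

Lemma deflator_nil n r (V : 'M[R]_(n, r)) : deflator V [::] = 1%:M.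
Proof.
rewrite /deflator -mulmxA (_ : pinv _ *m _ = 0) ?mulmx0 ?subr0 //.
by apply/matrixP => i j; rewrite !mxE big_ord0.
Qed.

Lemma nystrom_invariant0 n r (A : 'M[R]_n) (V : 'M[R]_(n, r)) d :
  A^T = A -> (forall j, d j = initial_diag A V j) ->
  nystrom_invariant A V 0 [::] V d.
Proof.
move=> symA hd; split=> //; rewrite ?deflator_nil.
- by exists 1%:M; rewrite ?mulmx1 ?trmx1.
- split=> [|q _|//]; first by exists 0; rewrite mulmx0 subr0.
  by rewrite mulmx1.
- rewrite mul1mx trmx1 mulmx1 subn0; split=> [j|//].
  by rewrite hd initial_diagE.
Qed.

Lemma nystrom_invariant_step n r (A : 'M[R]_n) (V : 'M[R]_(n, r)) (k : 'I_r)
    (s : seq 'I_n) (j : 'I_n) (W W' : 'M[R]_(n, r)) (d d' : 'I_n -> R) :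
  sympsd A -> V^T *m V = 1%:M ->
  nystrom_step A V k s j W d W' d' ->
  nystrom_invariant A V k s W d ->
  nystrom_invariant A V k.+1 (rcons s j) W' d'.
Proof.
move=> psdA hV [argj [H hH eW'] W'j0 hd'] [[Q QQ eW] Ws0 headW oblT [hd trM]].
set T := deflator V s in oblT hd trM.
set M := T *m compression A V *m T^T in hd trM.
have psdM : sympsd M by apply/sympsd_congr/compression_sympsd.
have [PP fP] := extend_id_orth hH; set P := extend_id H in eW' PP fP.
have tail i : row_tail_sqnorm W' i k = row_tail_sqnorm W i k.
  by rewrite eW' row_tail_sqnorm_rot.
have QQ' : (Q *m P)^T *m (Q *m P) = 1%:M.
  by rewrite trmx_mul mulmxA -(mulmxA P^T) QQ mulmx1.
have eV' : W' = V *m (Q *m P) by rewrite eW' eW mulmxA.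
have WW : W^T *m W = 1%:M by rewrite eW trmx_mul mulmxA -(mulmxA Q^T) hV mulmx1.
have WW' : W'^T *m W' = 1%:M.
  by rewrite eV' trmx_mul mulmxA -(mulmxA _ V^T) hV mulmx1.
(* These rows have tail norm 0, which the rotation preserves. *)
have Ws0' i (l : 'I_r) : i \in s -> (k <= l)%N -> W' i l = 0.
  move=> si; move: l; apply/row_tail_sqnorm_eq0; rewrite tail.
  by apply/row_tail_sqnorm_eq0 => l; exact: Ws0.
(* The reflector moves the whole tail of row [j] into column [k], so the denominator of the minimal
   ratio is the square of the pivot [w_j]. *)
have tailj : row_tail_sqnorm W j k = W' j k ^+ 2.
  rewrite -tail /row_tail_sqnorm (bigD1 k) //= big1 ?addr0 // => l /andP[kl nl].
  by rewrite W'j0 ?expr0n // ltn_neqAle kl eq_sym nl.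
have W'jk0 : W' j k != 0 by case: argj; rewrite tailj sqrf_eq0.
(* [P] keeps the first [k] entries of [q], so these are 0 by [headW]; row [j] then reduces to
   [W' j k * q k 0 = 0]. *)
have headW' (q : 'cV[R]_r) : vanishes (rcons s j) (W' *m q) ->
    forall l : 'I_r, (l < k.+1)%N -> q l 0 = 0.
  move=> vq; have q0 (l : 'I_r) : (l < k)%N -> q l 0 = 0.
    move=> lk; rewrite -(fixes_head_mull q _ fP lk); apply: headW lk.
    by rewrite mulmxA -eW' => i l0 si; apply: vq; rewrite mem_rcons inE si orbT.
  move=> l; rewrite ltnS leq_eqVlt => /orP[/eqP/val_inj ->|]; last exact: q0.
  have := vq j 0; rewrite mem_rcons inE eqxx => /(_ isT).
  rewrite mxE (bigD1 k) //= big1 ?addr0 => [/eqP|i ik].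
    by rewrite mulf_eq0 (negPf W'jk0) /= => /eqP.
  have [ik'|ki|/val_inj ik'] := ltngtP i k; first by rewrite q0 ?mulr0.
    by rewrite W'j0 ?mul0r.
  by rewrite ik' eqxx in ik.
pose w := V *m col k (Q *m P).
have ew : w = col k W' by rewrite /w eV' !colE !mulmxA.
have wE i : w i 0 = W' i k by rewrite ew mxE.
have vw : vanishes s w.
  by move=> i l si; rewrite ord1 wE Ws0'.
(* In the orthonormal basis of columns of [W'], such a vector has coefficient 0 on column [k], which
   is [w]. *)
have worth (q : 'cV[R]_r) :
    vanishes (rcons s j) (V *m q) -> (V *m q)^T *m w = 0.
  have -> : V *m q = W' *m ((Q *m P)^T *m q).
    by rewrite eV' mulmxA -(mulmxA V) (mulmx1C QQ') mulmx1.
  move=> /headW' /(_ k (ltnSn _)) ck0; rewrite ew colE.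
  rewrite trmx_mul mulmxA -(mulmxA _ W'^T) WW' mulmx1 -colE.
  by apply/matrixP => a b; rewrite !ord1 mxE [LHS]mxE ck0 mxE.
have wj0 : w j 0 != 0 by rewrite wE.
have oblT' := oblique_rcons oblT vw wj0 worth.
rewrite -/w -/(elim_mx w j (w j 0)^-1) in oblT'.
(* Uniqueness identifies the pseudoinverse formula for the longer tuple with the rank-one update. *)
have eT' := deflatorE hV oblT'.
have symM := proj1 psdM.
have ww : w^T *m w = 1%:M.
  apply/matrixP => a b; rewrite ew tr_col colE mulmxA -row_mul WW' -colE.
  by rewrite !ord1 !mxE eqxx.
(* [T] fixes [w^T] because [w] vanishes on [s]; the projector in the compression kills it because
   [w] is in the range of [V]. *)
have wM : w^T *m M = 0.
  have wP : w^T *m (1%:M - V *m V^T) = 0.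
    by rewrite mulmxBr mulmx1 mulmxA trmx_mul -(mulmxA _ V^T) hV mulmx1 subrr.
  have [_ fixT _] := oblT.
  by rewrite /M /compression !mulmxA fixT // wP !mul0mx.
have eM' : elim_mx w j (w j 0)^-1 *m T *m compression A V *m
    (elim_mx w j (w j 0)^-1 *m T)^T =
    elim_mx w j (w j 0)^-1 *m M *m (elim_mx w j (w j 0)^-1)^T.
  by rewrite trmx_mul !mulmxA.
split; rewrite ?eT' //; first by exists (Q *m P).
  move=> i l; rewrite mem_rcons inE => /orP[/eqP-> kl|si kl]; first exact: W'j0.
  by apply: Ws0' => //; exact: ltnW.
rewrite eM'; split=> [i|].
  (* The algorithm's update of [d] is the diagonal of this congruence. *)
  rewrite elim_mx_entry // hd' hd residual_columnE -/M !wE.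
  by rewrite ![col j M _ _]mxE exprVn; field.
(* It remains to bound [(r - k) (tr M + M_jj / w_j^2)] by [(r - k + 1) tr M], which is the averaging
   bound for the minimal ratio. *)
rewrite elim_mx_trace // wE exprVn subSS.
apply: le_trans trM.
have := argmin_ratio_le psdM (ltnW (ltn_ord k)) WW (j := j).
have argj' : is_argmin (fun i => row_tail_sqnorm W i k != 0)
            (fun i => M i i / row_tail_sqnorm W i k) j.
  by case: argj => tj minj; split=> // i ti; rewrite -!hd; exact: minj.
move=> /(_ argj'); rewrite tailj => le_tr.
rewrite subSn ?(ltnW (ltn_ord k)) // -natr1.
lra.
Qed.

End Step.

(** * End of the iteration and comparison with the Schur complement *)

Section Final.
Variable R : rcfType.

Lemma nystrom_output_invariant n r (A : 'M[R]_n) (V : 'M[R]_(n, r))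
    (J : r.-tuple 'I_n) :
  sympsd A -> V^T *m V = 1%:M -> adaptive_nystrom_output A V J ->
  exists W d, nystrom_invariant A V r J W d.
Proof.
move=> psdA hV [W [d [W0 d0 stepJ]]].
suff inv k : (k <= r)%N -> nystrom_invariant A V k (take k J) (W k) (d k).
  exists (W r), (d r); have := inv r (leqnn r).
  by rewrite -{3}(size_tuple J) take_size.
elim: k => [_|k IHk kr].
  rewrite take0 W0; apply: nystrom_invariant0 d0; exact: (proj1 psdA).
have nthJ : tnth J (Ordinal kr) = nth (tnth J (Ordinal kr)) J k.
  by rewrite {1}(tnth_nth (tnth J (Ordinal kr))).
have := nystrom_invariant_step psdA hV (stepJ (Ordinal kr)) (IHk (ltnW kr)).
by rewrite nthJ -take_nth ?size_tuple.
Qed.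

(** [select] has [size J] columns, which is not convertible to [r]; [X] is the reindexing between
    the two. *)
Lemma select_tuple n r (J : r.-tuple 'I_n) :
  exists X : 'M[R]_(size J, r),
    (select R J)^T = X *m (colsub (tnth J) 1%:M)^T.
Proof.
exists (rowsub (cast_ord (size_tuple J)) 1%:M).
rewrite mul_rowsub_mx mul1mx; apply/matrixP => i j; rewrite !mxE.
congr ((_ == _)%:R); case: J i => s sz i /=.
by rewrite !(tnth_nth j).
Qed.

Lemma trace_schur_le_deflated n r (A : 'M[R]_n) (V : 'M[R]_(n, r))
    (J : r.-tuple 'I_n) (W : 'M[R]_(n, r)) d :
  let E := colsub (tnth J) 1%:M in
  sympsd A -> E^T *m A *m E \in unitmx -> V^T *m V = 1%:M ->
  nystrom_invariant A V r J W d ->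
  \tr (A - A *m E *m invmx (E^T *m A *m E) *m (E^T *m A)) <=
  r.+1%:R * \tr (compression A V).
Proof.
move=> E psdA uG hV [[Q QQ eW] _ headW [[N eT] fixT vT] [_ trM]].
set T := deflator V J in eT fixT vT trM.
move: trM; rewrite subSnn mul1r; apply: le_trans.
(* The columns of [T *m V = W *m q] vanish on [J]; at [k = r] the invariant forces every entry of
   [q] to be 0. *)
have TV : T *m V = 0.
  pose q := Q^T *m (1%:M - N *m V).
  have eTV : T *m V = W *m q.
    rewrite eT mulmxBl mul1mx /q eW mulmxA -(mulmxA V Q) (mulmx1C QQ) mulmx1.
    by rewrite mulmxBr mulmx1 mulmxA.
  suff q0 : q = 0 by rewrite eTV q0 mulmx0.
  apply/matrixP => i j; have := headW (col j q) _ i (ltn_ord i).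
  rewrite !mxE; apply=> a b Ja; rewrite colE mulmxA -eTV mxE big1 // => c _.
  by rewrite mxE big1 ?mul0r // => e _; rewrite vT ?mul0r.
have TP : T *m (1%:M - V *m V^T) = T.
  by rewrite mulmxBr mulmx1 mulmxA TV mul0mx subr0.
have -> : T *m compression A V *m T^T = T *m A *m T^T.
  rewrite /compression !mulmxA TP -mulmxA -{1}compressor_sym -trmx_mul.
  by rewrite TP.
have [X eX] := select_tuple J.
(* This is the form [1 - M E^T] over which the Schur complement has least trace. *)
have -> : T = 1%:M - (V *m pinv ((select R J)^T *m V) *m X) *m E^T.
  by rewrite /T /deflator {2}eX mulmxA.
exact: schur_trace_le.
Qed.

End Final.

Theorem corollary5p2 (R : realType) (n r : nat)
    (A : 'M[R]_n) (V : 'M[R]_(n, r)) (J : r.-tuple 'I_n)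
    (hA : sympsd A)
    (hV : V^T *m V = 1%:M)
    (hJ : adaptive_nystrom_output A V J)
    (hAJJ : mxsub (tnth J) (tnth J) A \in unitmx) :
  nuclear_norm (A - colsub (tnth J) A *m invmx (mxsub (tnth J) (tnth J) A)
                      *m rowsub (tnth J) A)
  <= r.+1%:R * nuclear_norm ((1%:M - V *m V^T) *m A *m (1%:M - V *m V^T)).
Proof.
pose E : 'M[R]_(n, r) := colsub (tnth J) 1%:M.
have eC : colsub (tnth J) A = A *m E by rewrite mulmx_colsub mulmx1.
have eR : rowsub (tnth J) A = E^T *m A.
  by rewrite /E trmx_mxsub trmx1 mul_rowsub_mx mul1mx.
have eG : mxsub (tnth J) (tnth J) A = E^T *m A *m E.
  by rewrite mxsubcr eR mulmx_colsub mulmx1.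
rewrite eG in hAJJ *; rewrite eC eR.
have [W [d inv]] := nystrom_output_invariant hA hV hJ.
rewrite nuclear_norm_psd; last exact: schur_sympsd.
rewrite nuclear_norm_psd; last exact: compression_sympsd.
exact: trace_schur_le_deflated inv.
Qed.
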